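(* Let $X$ be a separable uniformly convex Banach space with the $\pi_\lambda$-property, where $1\leq\lambda<\Lambda_X$. If $Z$ is a closed subspace of $\mathcal{B}(X)$ containing $\mathcal{F}(X)$, then $Z$ has the UBCP.
   Context: $\mathcal{B}(X)$ is the Banach space of bounded linear operators $X\to X$ with the operator norm, and $\mathcal{F}(X)$ is its subspace of bounded finite-rank operators. Uniform ball-covering property (UBCP): a Banach space $Z$ with unit sphere $S_Z$ has the UBCP if there exist $r>0$ and a sequence $(z_j)_{j\ge1}$ in $Z$ such that $S_Z\subseteq\bigcup_{j\ge1}B(z_j,r)$ and $r<\inf_{j\ge1}\|z_j\|$, where $B(z,r)$ is the open ball with center $z$ and radius $r$. By convention, if $Z=\{0\}$ (so $S_Z=\emptyset$) the UBCP assertion is regarded as trivially true. $\pi_\lambda$-property ($\lambda\ge1$): a Banach space $X$ has it if for every finite set $A\subseteq X$ and every $\varepsilon>0$ there is a finite-rank projection (bounded linear idempotent) $P:X\to X$ with $\|P\|\leq\lambda$ and $\|Px-x\|<\varepsilon$ for all $x\in A$. Modulus of convexity: $\delta_X(\varepsilon)=\inf\{1-\|\frac{x+y}{2}\| : x,y\in X,\ \|x\|\le1,\ \|y\|\le1,\ \|x-y\|\ge\varepsilon\}$ for $0<\varepsilon\le2$; $X$ is uniformly convex iff $\delta_X(\varepsilon)>0$ for all $0<\varepsilon\le2$. The constant $\Lambda_X$: for uniformly convex $X$, $0<\eta<1$, $\Delta=\delta_X(\eta)$ and $0<t<\Delta/4$, put $\alpha_X(\eta,t)=\min\{\frac{\Delta}{4},\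 \frac{\Delta}{2}-t,\ \frac{t(1-\eta)}{2}\}>0$, and define $\Lambda_X=1+\sup\{\alpha_X(\eta,t): 0<\eta<1,\ 0<t<\delta_X(\eta)/4\}$, so that $\Lambda_X>1$. *)

(* Defs.v *)
From HB Require Import structures.
From mathcomp Require Import all_boot all_order all_algebra.
From mathcomp Require Import complex.
From mathcomp Require Import all_classical all_reals all_analysis.

Set Implicit Arguments.
Unset Strict Implicit.
Unset Printing Implicit Defensive.

Import Order.TTheory GRing.Theory Num.Theory.
Import numFieldNormedType.Exports.

Local Open Scope classical_set_scope.
Local Open Scope ring_scope.

(* A Banach space is real or complex.  In both cases the library's norm takes
   its values in the scalar field, so a real-valued norm [rnorm] is derived
   from it. *)
Inductive scalar_kind := RealScalars | ComplexScalars.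

Definition scalar_field (R : realType) (s : scalar_kind) : numFieldType :=
  match s with
  | RealScalars => (R : numFieldType)
  | ComplexScalars => (R[i] : numFieldType)
  end.

Definition of_real (R : realType) (s : scalar_kind) : R -> scalar_field R s :=
  match s with
  | RealScalars => fun r => r
  | ComplexScalars => fun r => (r%:C)%C
  end.
Arguments of_real {R} s r.

Definition to_real (R : realType) (s : scalar_kind) : scalar_field R s -> R :=
  match s with
  | RealScalars => fun z => z
  | ComplexScalars => fun z => complex.Re z
  end.

Section scalar_field_theory.
Context {R : realType} {s : scalar_kind}.
Implicit Types (a b : scalar_field R s) (r : R).

Lemma to_realK r : to_real (of_real s r) = r.
Proof. by case: s. Qed.

Lemma of_realK a : 0 <= a -> of_real s (to_real a) = a.
Proof.
case: s a => //= -[x y] /=.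
by rewrite lecE /= => /andP[/eqP -> _].
Qed.

Lemma to_realD a b : to_real (a + b) = to_real a + to_real b.
Proof. by case: s a b => //= -[? ?] [? ?]. Qed.

Lemma ler_to_real a b : a <= b -> to_real a <= to_real b.
Proof. by case: s a b => //= -[? ?] [? ?]; rewrite lecE /= => /andP[]. Qed.

Lemma of_realD r1 r2 : of_real s (r1 + r2) = of_real s r1 + of_real s r2.
Proof. by case: s => //=; apply/eqP; rewrite eq_complex /= addr0 !eqxx. Qed.

Lemma of_realM r1 r2 : of_real s (r1 * r2) = of_real s r1 * of_real s r2.
Proof.
case: s => //=; apply/eqP.
by rewrite eq_complex /= !mulr0 mul0r subr0 addr0 !eqxx.
Qed.

Lemma of_real0 : of_real s 0 = 0 :> scalar_field R s.
Proof. by case: s. Qed.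

Lemma ler_of_real r1 r2 : (of_real s r1 <= of_real s r2) = (r1 <= r2).
Proof. by case: s => //=; rewrite lecE /= eqxx. Qed.

Lemma to_realM a b : 0 <= a -> 0 <= b ->
  to_real (a * b) = to_real a * to_real b.
Proof.
move=> a0 b0; rewrite -[in LHS](of_realK a0) -[in LHS](of_realK b0).
by rewrite -of_realM to_realK.
Qed.

End scalar_field_theory.

Definition rnorm (R : realType) (s : scalar_kind) (V : normedModType (scalar_field R s))
  (v : V) : R := to_real `|v|.

Section rnorm_theory.
Context {R : realType} {s : scalar_kind} {V : normedModType (scalar_field R s)}.
Implicit Types v w : V.

Lemma rnorm_ge0 v : 0 <= rnorm v.
Proof.
by rewrite -(@to_realK R s 0) of_real0; apply: ler_to_real; exact: normr_ge0.
Qed.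

Lemma of_real_rnorm v : of_real s (rnorm v) = `|v|.
Proof. by apply: of_realK; exact: normr_ge0. Qed.

Lemma rnorm0 : rnorm (0 : V) = 0.
Proof. by rewrite /rnorm normr0 -of_real0 to_realK. Qed.

Lemma rnorm0_eq0 v : rnorm v = 0 -> v = 0.
Proof.
by move=> v0; apply/eqP; rewrite -normr_eq0 -of_real_rnorm v0 of_real0.
Qed.

Lemma ler_rnormD v w : rnorm (v + w) <= rnorm v + rnorm w.
Proof. by rewrite /rnorm -to_realD; apply: ler_to_real; exact: ler_normD. Qed.

Lemma rnormZ (a : scalar_field R s) v : rnorm (a *: v) = to_real `|a| * rnorm v.
Proof. by rewrite /rnorm normrZ to_realM. Qed.

End rnorm_theory.

Definition is_bounded_linear (R : realType) (s : scalar_kind)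
    (X : normedModType (scalar_field R s)) (T : X -> X) : Prop :=
  linear T /\ exists M : R, forall x, rnorm (T x) <= M * rnorm x.

Section bounded_operators.
Variables (R : realType) (s : scalar_kind) (X : normedModType (scalar_field R s)).

Definition bounded_linear_pred : {pred X -> X} :=
  [pred T | `[< is_bounded_linear T >]].

Lemma bounded_linear_submod_closed : submod_closed bounded_linear_pred.
Proof.
split => [|a S T].
  rewrite inE; split.
    by move=> a x y /=; rewrite scaler0 addr0.
  by exists 0 => x; rewrite mul0r rnorm0.
rewrite !inE => -[linS [M SM]] [linT [N TN]]; split.
  move=> b x y; rewrite /= !fctE linS linT !scalerDr !scalerA (mulrC b a).
  by rewrite addrACA.
exists (to_real `|a| * M + N) => x.
rewrite !fctE (le_trans (ler_rnormD _ _))// mulrDl lerD// rnormZ -mulrA.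
by rewrite ler_wpM2l// -(@to_realK R s 0) of_real0; exact: ler_to_real.
Qed.

(* The space B(X); its norm, given below, is [opnorm] (see [rnorm_bop]). *)
Record bop := Bop {
  bop_fun :> X -> X;
  bop_subproof : bop_fun \in bounded_linear_pred }.

HB.instance Definition _ := [isSub for bop_fun].
HB.instance Definition _ := [Choice of bop by <:].
HB.instance Definition _ := GRing.SubChoice_isSubLmodule.Build _ _ _ bop
  (GRing.submod_closed_semi bounded_linear_submod_closed).

Lemma bopP (T : bop) : is_bounded_linear T.
Proof. by have := bop_subproof T; rewrite inE. Qed.

Lemma bopE (T U : bop) : T =1 U -> T = U.
Proof. by move=> TU; apply/val_inj/funext. Qed.

Lemma bopD (T U : bop) x : (T + U) x = T x + U x.
Proof. by []. Qed.

Lemma bopZ a (T : bop) x : (a *: T) x = a *: T x.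
Proof. by []. Qed.

Lemma bop_linear (T : bop) : linear T. Proof. by have [] := bopP T. Qed.

HB.instance Definition _ (T : bop) :=
  GRing.isLinear.Build (scalar_field R s) X X *:%R T (bop_linear T).

Definition opnorm (T : bop) : R :=
  sup [set rnorm (T x) | x in [set x | rnorm x <= 1]].

Lemma opnorm_has_sup (T : bop) :
  has_sup [set rnorm (T x) | x in [set x | rnorm x <= 1]].
Proof.
split; first by exists (rnorm (T 0)); exists 0 => //=; rewrite rnorm0.
have [_ [M TM]] := bopP T; exists (Num.max M 0) => _ [x /= x1 <-].
rewrite (le_trans (TM x))// (@le_trans _ _ (Num.max M 0 * rnorm x))//.
  by rewrite ler_wpM2r ?rnorm_ge0// le_max lexx.
by rewrite ler_piMr// le_max lexx orbT.
Qed.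

Lemma opnorm_ub (T : bop) x : rnorm x <= 1 -> rnorm (T x) <= opnorm T.
Proof.
by move=> x1; apply: sup_upper_bound; [exact: opnorm_has_sup|exists x].
Qed.

Lemma opnorm_lub (T : bop) (M : R) :
  (forall x, rnorm x <= 1 -> rnorm (T x) <= M) -> opnorm T <= M.
Proof.
move=> TM; apply: ge_sup; first by have [] := opnorm_has_sup T.
by move=> _ [x /= x1 <-]; exact: TM.
Qed.

Lemma opnorm_ge0 (T : bop) : 0 <= opnorm T.
Proof. by rewrite (le_trans (rnorm_ge0 (T 0)))// opnorm_ub// rnorm0. Qed.

Lemma opnormP (T : bop) x : rnorm (T x) <= opnorm T * rnorm x.
Proof.
have [x0|x0] := eqVneq (rnorm x) 0.
  by rewrite (rnorm0_eq0 x0) linear0 !rnorm0 mulr0.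
have x_gt0 : 0 < rnorm x by rewrite lt_neqAle eq_sym x0 rnorm_ge0.
have normc : to_real `|of_real s (rnorm x)^-1| = (rnorm x)^-1.
  by rewrite ger0_norm ?to_realK// -of_real0 ler_of_real invr_ge0 rnorm_ge0.
have : rnorm (T (of_real s (rnorm x)^-1 *: x)) <= opnorm T.
  by apply: opnorm_ub; rewrite rnormZ normc mulVf.
by rewrite linearZ rnormZ normc ler_pdivrMl// mulrC.
Qed.

Lemma ler_opnormD (T U : bop) : opnorm (T + U) <= opnorm T + opnorm U.
Proof.
apply: opnorm_lub => x x1; rewrite bopD (le_trans (ler_rnormD _ _))//.
by rewrite lerD// opnorm_ub.
Qed.

Lemma opnorm_eq0 (T : bop) : opnorm T = 0 -> T = 0.
Proof.
move=> T0; apply: bopE => x; apply: rnorm0_eq0; apply/le_anti.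
by rewrite rnorm_ge0 andbT; have := opnormP T x; rewrite T0 mul0r.
Qed.

Lemma opnorm_leZ a (T : bop) : opnorm (a *: T) <= to_real `|a| * opnorm T.
Proof.
apply: opnorm_lub => x x1; rewrite bopZ rnormZ ler_wpM2l ?opnorm_ub//.
by rewrite -(@to_realK R s 0) of_real0 ler_to_real.
Qed.

Lemma opnormZ a (T : bop) : opnorm (a *: T) = to_real `|a| * opnorm T.
Proof.
have [->|a0] := eqVneq a 0.
  apply/le_anti; rewrite opnorm_leZ/= normr0 -of_real0 to_realK mul0r.
  exact: opnorm_ge0.
apply/le_anti; rewrite opnorm_leZ/=.
have a_ge0 (b : scalar_field R s) : 0 <= to_real `|b|.
  by rewrite -(@to_realK R s 0) of_real0 ler_to_real.
rewrite -[in leLHS](scale1r T) -(mulVf a0) -scalerA.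
rewrite (le_trans (ler_wpM2l (a_ge0 a) (opnorm_leZ a^-1 _)))//.
rewrite mulrA -to_realM// -normrM mulfV// normr1.
have -> : to_real (1 : scalar_field R s) = 1 by case: (s).
by rewrite mul1r.
Qed.

Definition bop_norm (T : bop) : scalar_field R s := of_real s (opnorm T).

Fact bop_normD (T U : bop) : bop_norm (T + U) <= bop_norm T + bop_norm U.
Proof. by rewrite /bop_norm -of_realD ler_of_real ler_opnormD. Qed.

Fact bop_normZ a (T : bop) : bop_norm (a *: T) = `|a| * bop_norm T.
Proof. by rewrite /bop_norm opnormZ of_realM of_realK. Qed.

Fact bop_norm_eq0 (T : bop) : bop_norm T = 0 -> T = 0.
Proof.
move=> T0; apply: opnorm_eq0.
by rewrite -(to_realK (s := s) (opnorm T)) -/(bop_norm T) T0 -of_real0 to_realK.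
Qed.

HB.instance Definition _ :=
  Lmodule_isNormed.Build (scalar_field R s) bop bop_normD bop_normZ bop_norm_eq0.

Lemma rnorm_bop (T : bop) : rnorm T = opnorm T.
Proof. exact: to_realK. Qed.

Definition finite_rank (T : bop) : Prop :=
  exists (n : nat) (b : 'I_n -> X), forall x,
    exists c : 'I_n -> scalar_field R s, T x = \sum_(i < n) c i *: b i.

End bounded_operators.

Section geometry.
Variables (R : realType) (s : scalar_kind) (X : normedModType (scalar_field R s)).

Definition separable_space : Prop :=
  exists2 D : set X, countable D & dense D.

Definition pi_property (lambda : R) : Prop :=
  forall (A : set X) (e : R), finite_set A -> 0 < e ->
    exists P : bop X, [/\ finite_rank P, forall x, P (P x) = P x,
      rnorm P <= lambda & forall x, A x -> rnorm (P x - x) < e].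

(* The infimum is taken in the extended reals because the set is empty when
   X = {0}: the modulus is then +oo and {0} is uniformly convex. *)
Definition modulus_convexity (e : R) : \bar R :=
  ereal_inf [set (1 - rnorm (2^-1 *: (xy.1 + xy.2)))%:E |
    xy in [set xy : X * X |
      [/\ rnorm xy.1 <= 1, rnorm xy.2 <= 1 & e <= rnorm (xy.1 - xy.2)]]].

Definition uniformly_convex : Prop :=
  forall e : R, 0 < e -> e <= 2 -> (0 < modulus_convexity e)%E.

Definition alpha_const (eta t : R) : \bar R :=
  let Delta := modulus_convexity eta in
  mine (Delta * 4^-1%:E)%E
    (mine (Delta * 2^-1%:E - t%:E)%E (t * (1 - eta) / 2)%:E).

Definition Lambda_const : \bar R :=
  (1 + ereal_sup [set a | exists eta t : R,
    [/\ (0 < eta < 1)%R, (0 < t)%R,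
        t%:E < modulus_convexity eta * 4^-1%:E
      & a = alpha_const eta t]])%E.

End geometry.

Section subspaces.
Variables (R : realType) (s : scalar_kind) (V : normedModType (scalar_field R s)).

Definition is_subspace (Z : set V) : Prop :=
  Z 0 /\ forall (a : scalar_field R s) (x y : V), Z x -> Z y -> Z (a *: x + y).

Definition UBCP (Z : set V) : Prop :=
  Z = [set 0] \/
  exists (r : R) (z : nat -> V),
    [/\ 0 < r, forall j, Z (z j),
      Z `&` [set x | rnorm x = 1] `<=`
        \bigcup_j [set x | rnorm (x - z j) < r]
    & r < inf (range (fun j => rnorm (z j)))].

End subspaces.

(* Main.v *)
Require Import Defs.
From HB Require Import structures.
From mathcomp Require Import all_boot all_order all_algebra.
From mathcomp Require Import complex ring lra.
From mathcomp Require Import all_classical all_reals all_analysis.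

Set Implicit Arguments.
Unset Strict Implicit.
Unset Printing Implicit Defensive.

Import Order.TTheory GRing.Theory Num.Theory.
Import numFieldNormedType.Exports.

Local Open Scope classical_set_scope.
Local Open Scope ring_scope.

(** The centres of the covering balls are large multiples [sigma f_x (.) y] of
    norm-one operators of rank one, where [x] and [y] run over a countable
    dense subset of the unit sphere of [X] and [f_x] is a functional of norm
    one that attains its norm at [x] ([norming_functional]).  Let [T] have norm
    one, let [x] be a point of that subset at which [T] almost attains its
    norm, and let [y] be one close to [T x].  To estimate
    [T u - sigma f_x(u) y] for [u] in the unit ball, rotate [u] so that [f_x(u)]
    becomes nonnegative (this does not change the norm), and let [d] be given
    by the modulus of convexity.
    - If [f_x(u) <= 1 - d], the norm is at most [1 + sigma (1 - d)], which is
      [sigma - 1] once [sigma = 2 / d].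
    - Otherwise the midpoint of [u] and [x] has norm larger than [1 - d],
      so uniform convexity puts [u] near [x]; then [T u] is near [y] and the
      norm is, up to a small error, [|1 - sigma f_x(u)|].  As [sigma f_x(u)]
      lies between [sigma - 2] and [sigma], and [sigma >= 2], this is at most
      [sigma - 1].
    Thus [T] lies at a distance less than [sigma - 1 / 4] from a centre, while
    every centre has norm at least [sigma] ([rank_one_ball]).  There are
    countably many centres, because only the norming functionals of countably
    many points occur; since they have finite rank, they belong to [Z].

    Norming functionals exist by the Hahn-Banach theorem, proved here in the
    form: every sublinear functional on a real vector space dominates a linear
    one, because a minimal sublinear functional is linear.  It is applied to
    the norm of [X], seen as a real space; in the complex case the real
    functional is then completed to a complex one. *)

(** * The Hahn-Banach theorem for sublinear functionals *)

Section sublinear_functionals.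
Context {R : realType} {V : lmodType R}.
Implicit Types (p q : V -> R) (u v : V).

(** Only the inequality is asked in the homogeneity condition; equality follows
    by scaling back with the inverse ([sublinearZ]).  The weaker form is the
    one that infima of functionals inherit directly. *)
Definition sublinear q :=
  (forall u v, q (u + v) <= q u + q v) /\
  (forall (t : R) u, 0 <= t -> q (t *: u) <= t * q u).

Lemma sublinearZ q t u : sublinear q -> 0 <= t -> q (t *: u) = t * q u.
Proof.
move=> [qD qZ] t0; apply/eqP; rewrite eq_le qZ//=.
have [->|tn0] := eqVneq t 0.
  rewrite mul0r scale0r; have := qD 0 0; rewrite addr0; lra.
have tp : 0 < t by rewrite lt_def tn0.
have := qZ t^-1 (t *: u); rewrite invr_ge0 => /(_ t0).
by rewrite scalerA mulVf// scale1r ler_pdivlMl.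
Qed.

Lemma sublinearN q u : sublinear q -> - q (- u) <= q u.
Proof.
move=> sq; have := sq.1 u (- u); rewrite subrr.
have := @sublinearZ q 0 0 sq (lexx _); rewrite scale0r mul0r => ->; lra.
Qed.

(** The largest sublinear functional below [q] whose value at [- v] is at most
    [- q v], hence one that is linear along the line spanned by [v]. *)
Definition tilt q v u : R :=
  inf [set q (u + t *: v) - t * q v | t in [set t | 0 <= t]].

Lemma tilt_lb q v u t : sublinear q -> 0 <= t ->
  tilt q v u <= q (u + t *: v) - t * q v.
Proof.
move=> sq t0; apply: ge_inf; last by exists t.
exists (- q (- u)) => _ [r /= r0 <-]; rewrite -(sublinearZ _ sq r0).
have := sq.1 (u + r *: v) (- u); rewrite addrAC subrr add0r; lra.
Qed.

Lemma lb_tilt q v u a :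
  (forall t, 0 <= t -> a <= q (u + t *: v) - t * q v) -> a <= tilt q v u.
Proof.
move=> h; apply: lb_le_inf; first by exists (q (u + 0 *: v) - 0 * q v), 0 => /=.
by move=> _ [t /= t0 <-]; exact: h.
Qed.

Lemma tilt_le q v u : sublinear q -> tilt q v u <= q u.
Proof.
by move=> sq; have := tilt_lb v u sq (lexx 0); rewrite scale0r addr0 mul0r subr0.
Qed.

Lemma sublinear_tilt q v : sublinear q -> sublinear (tilt q v).
Proof.
move=> sq; split=> [u w|a u].
  rewrite -lerBlDr; apply: lb_tilt => t t0; rewrite lerBlDr -lerBlDl.
  apply: lb_tilt => r r0; rewrite lerBlDl.
  have := tilt_lb v (u + w) sq (addr_ge0 t0 r0).
  move/le_trans; apply; rewrite scalerDl addrACA mulrDl.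
  by have := sq.1 (u + t *: v) (w + r *: v); lra.
rewrite le_eqVlt => /orP[/eqP<-|a0].
  rewrite mul0r scale0r (le_trans (tilt_le _ _ sq))//.
  by rewrite -(scale0r 0) sublinearZ// mul0r.
rewrite -ler_pdivrMl//; apply: lb_tilt => t t0; rewrite ler_pdivrMl//.
have := tilt_lb v (a *: u) sq (mulr_ge0 (ltW a0) t0).
by rewrite -scalerA -scalerDr (sublinearZ _ sq (ltW a0)) mulrBr mulrA.
Qed.

(** For a chain the infimum is still subadditive: given [q] and [r] in the
    chain, the smaller of the two is below both, and bounds the infimum at
    [u + w].  The infimum is finite because every [q <= p] satisfies
    [- p (- u) <= q u]. *)
Lemma sublinear_inf (A : set (V -> R)) p : A !=set0 ->
    (forall q, A q -> sublinear q /\ forall u, q u <= p u) ->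
    (forall q r, A q -> A r -> (forall u, q u <= r u) \/ (forall u, r u <= q u)) ->
  let m u := inf [set q u | q in A] in
  sublinear m /\ forall q u, A q -> m u <= q u.
Proof.
move=> [q0 Aq0] Ap Atot m.
have mle q u : A q -> m u <= q u.
  move=> Aq; apply: ge_inf; last by exists q.
  exists (- p (- u)) => _ [r Ar <-]; have [sr rp] := Ap r Ar.
  by rewrite (le_trans _ (sublinearN u sr))// lerN2.
have lem_inf u a : (forall q, A q -> a <= q u) -> a <= m u.
  move=> h; apply: lb_le_inf; first by exists (q0 u), q0.
  by move=> _ [q /= Aq <-]; exact: h.
split=> //; split=> [u w|a u].
  rewrite -lerBlDr; apply: (lem_inf) => q Aq; rewrite lerBlDr -lerBlDl.
  apply: (lem_inf) => r Ar; rewrite lerBlDl.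
  have [sq _] := Ap _ Aq; have [sr _] := Ap _ Ar.
  have [/(_ w) qr|/(_ u) rq] := Atot _ _ Aq Ar.
    by have := mle q (u + w) Aq; have := sq.1 u w; lra.
  by have := mle r (u + w) Ar; have := sr.1 u w; lra.
rewrite le_eqVlt => /orP[/eqP<-|a0].
  have [sq _] := Ap _ Aq0; rewrite mul0r scale0r (le_trans (mle _ _ Aq0))//.
  by rewrite -(scale0r 0) sublinearZ// mul0r.
rewrite -ler_pdivrMl//; apply: (lem_inf) => q Aq; rewrite ler_pdivrMl//.
by rewrite -(sublinearZ _ (Ap _ Aq).1 (ltW a0)) mle.
Qed.

Lemma minimal_sublinear p : sublinear p ->
  exists q, [/\ sublinear q, forall u, q u <= p u &
    forall r, sublinear r -> (forall u, r u <= q u) -> r = q].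
Proof.
move=> sp; pose T := {q : V -> R | sublinear q /\ forall u, q u <= p u}.
pose below (q r : T) := `[< forall u, sval r u <= sval q u >].
have [||||q qmin] := @Zorn T below.
- by move=> q; apply/asboolP => u.
- move=> q r k /asboolP h /asboolP h'; apply/asboolP => u.
  exact: le_trans (h' u) (h u).
- move=> [q ?] [r ?] /asboolP /= h /asboolP /= h'; apply/eq_exist/funext => u.
  by apply/eqP; rewrite eq_le h h'.
- move=> A Atot; have [[q0 Aq0]|A0] := pselect (A !=set0); last first.
    by exists (exist _ p (conj sp (fun u => lexx (p u)))) => q Aq; case: A0; exists q.
  have [|||sm mle] := @sublinear_inf (sval @` A) p.
  + by exists (sval q0), q0.
  + by move=> _ [q _ <-]; exact: svalP q.
  + move=> _ _ [q Aq <-] [r Ar <-].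
    by have [/asboolP|/asboolP] := Atot _ _ Aq Ar; [right|left].
  have mp u : inf [set q u | q in sval @` A] <= p u.
    by apply: le_trans ((svalP q0).2 u); apply: mle; exists q0.
  pose m := exist (fun q => sublinear q /\ forall u, q u <= p u) _ (conj sm mp).
  exists m => q Aq; apply/asboolP => u /=.
  by apply: mle; exists q.
exists (sval q); have [sq qp] := svalP q; split=> // r sr rq.
have rp u : r u <= p u := le_trans (rq u) (qp u).
by have := qmin (exist _ r (conj sr rp)); rewrite /below; move/(_ (asboolT rq)) => <-.
Qed.

(** Tilting a minimal [q] along [v] leaves it unchanged, which says that
    [q u <= q (u + v) - q v]: together with subadditivity, [q] is additive. *)
Lemma hahn_banach p : sublinear p ->
  exists f : {linear V -> R^o}, forall u, f u <= p u.
Proof.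
move=> sp; have [q [sq qp qmin]] := minimal_sublinear sp.
have qD u v : q (u + v) = q u + q v.
  apply/eqP; rewrite eq_le sq.1/=.
  have tq : tilt q v = q.
    by apply: qmin; [exact: sublinear_tilt|move=> w; exact: tilt_le].
  have := tilt_lb v u sq ler01; rewrite tq scale1r mul1r; lra.
have q0 : q 0 = 0 by rewrite -(scale0r 0) sublinearZ// mul0r.
have qN u : q (- u) = - q u.
  by apply/eqP; rewrite -subr_eq0 opprK -qD addNr q0.
have ql : linear (q : V -> R^o).
  move=> a u v; rewrite qD; congr (_ + _).
  have [a0|/ltW a0] := leP 0 a; first exact: sublinearZ.
  rewrite -[a]opprK scaleNr qN sublinearZ ?oppr_ge0//.
  by rewrite scaleNr.
pose Q := GRing.isLinear.Build R V R^o *:%R q ql.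
by exists (HB.pack_for {linear V -> R^o} q Q).
Qed.

(** Dominating the tilt of [p] along [x] rather than [p] itself forces
    [f (- x) <= - p x]. *)
Lemma hahn_banach_at p x : sublinear p ->
  exists2 f : {linear V -> R^o}, forall u, f u <= p u & f x = p x.
Proof.
move=> sp; have [f fp] := hahn_banach (sublinear_tilt x sp).
have fle u : f u <= p u := le_trans (fp u) (tilt_le x u sp).
exists f => //; apply/eqP; rewrite eq_le fle/=.
have := le_trans (fp (- x)) (tilt_lb x (- x) sp ler01).
by rewrite linearN scale1r addNr -(scale0r 0) sublinearZ// mul0r mul1r sub0r lerN2.
Qed.

End sublinear_functionals.

(** * From real functionals to real or complex ones *)

Section restriction_of_scalars.
Context {R : realType} {s : scalar_kind}.

Lemma of_real1 : of_real s 1 = 1 :> scalar_field R s. Proof. by case: s. Qed.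

Lemma ltr_of_real (r1 r2 : R) : (of_real s r1 < of_real s r2) = (r1 < r2).
Proof.
by rewrite !lt_neqAle ler_of_real (inj_eq (can_inj (@to_realK R s))).
Qed.

Lemma to_real1 : to_real (1 : scalar_field R s) = 1.
Proof. by case: s. Qed.

Definition realified (V : lmodType (scalar_field R s)) : Type := V.

Section realified_lmodule.
Variable V : lmodType (scalar_field R s).

HB.instance Definition _ := GRing.Zmodule.on (realified V).

Definition real_scale (r : R) (v : realified V) : realified V :=
  of_real s r *: (v : V).

Fact real_scaleA a b v : real_scale a (real_scale b v) = real_scale (a * b) v.
Proof. by rewrite /real_scale scalerA of_realM. Qed.

Fact real_scale1 : left_id 1 real_scale.
Proof.
by move=> v; rewrite /real_scale of_real1 scale1r.
Qed.

Fact real_scaleDr : right_distributive real_scale +%R.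
Proof. by move=> a u v; rewrite /real_scale scalerDr. Qed.

Fact real_scaleDl v : {morph real_scale^~ v : a b / a + b}.
Proof. by move=> a b; rewrite /real_scale of_realD scalerDl. Qed.

HB.instance Definition _ := GRing.Zmodule_isLmodule.Build R (realified V)
  real_scaleA real_scale1 real_scaleDr real_scaleDl.

End realified_lmodule.

Lemma to_real_norm_of_real (r : R) : 0 <= r -> to_real `|of_real s r| = r.
Proof.
by move=> r0; rewrite ger0_norm ?to_realK// -of_real0 ler_of_real.
Qed.

Lemma rnormZr (V : normedModType (scalar_field R s)) (r : R) (v : V) :
  0 <= r -> rnorm (of_real s r *: v) = r * rnorm v.
Proof. by move=> r0; rewrite rnormZ to_real_norm_of_real. Qed.

Lemma sublinear_rnorm (V : normedModType (scalar_field R s)) :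
  @sublinear R (realified V) (fun v => rnorm (v : V)).
Proof.
split=> [u v|t u t0]; first exact: ler_rnormD.
by rewrite -[leLHS]/(rnorm (of_real s t *: (u : V))) rnormZr.
Qed.

(** The rotation that makes a scalar nonnegative; it lets bounds on real parts
    be turned into bounds on absolute values, over both fields at once. *)
Lemma phase (F : numFieldType) (a : F) : exists2 c : F, `|c| = 1 & c * a = `|a|.
Proof.
have [->|a0] := eqVneq a 0; first by exists 1; rewrite ?normr1// mulr0 normr0.
exists (`|a| / a); last by rewrite divfK.
by rewrite normrM normfV normr_id mulfV// normr_eq0.
Qed.

End restriction_of_scalars.

(** A complex linear [f] satisfies [Im (f u) = - Re (f (i u))], so the formula
    [f u = g u - i g (i u)] is the only possible one. *)
Lemma complexification (R : realType) (V : lmodType R[i])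
    (g : {linear @realified R ComplexScalars V -> R^o}) :
  exists f : {linear V -> (R[i])^o}, forall u, complex.Re (f u) = g u.
Proof.
pose f (u : V) : (R[i])^o := (g u +i* - g ('i%C *: u))%C.
have gZ (r : R) (u : V) : g (r%:C%C *: u) = r * g u.
  exact: (linearZ_LR g r (u : @realified R ComplexScalars V)).
have gD (u v : V) : g (u + v) = g u + g v by exact: linearD.
have gN (u : V) : g (- u) = - g u by exact: linearN.
have fl : linear f.
  move=> -[a b] u v.
  have abE : (a +i* b)%C = a%:C%C + b%:C%C * 'i%C :> R[i].
    by apply/eqP; rewrite eq_complex /=; apply/andP; split; apply/eqP; ring.
  have zE : (a +i* b)%C *: u = a%:C%C *: u + b%:C%C *: ('i%C *: u).
    by rewrite scalerA -scalerDl -abE.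
  have izE : 'i%C *: ((a +i* b)%C *: u) = a%:C%C *: ('i%C *: u) - b%:C%C *: u.
    rewrite !scalerA -scaleNr -scalerDl; congr (_ *: _).
    by apply/eqP; rewrite eq_complex /=; apply/andP; split; apply/eqP; ring.
  rewrite /f scalerDr izE zE !gD gN !gZ.
  by apply/eqP; rewrite eq_complex /=; apply/andP; split; apply/eqP; ring.
pose F := GRing.isLinear.Build R[i] V (R[i])^o *:%R f fl.
by exists (HB.pack_for {linear V -> (R[i])^o} f F).
Qed.

Lemma extend_real_functional (R : realType) (s : scalar_kind)
    (V : lmodType (scalar_field R s)) (g : {linear realified V -> R^o}) :
  exists f : {linear V -> (scalar_field R s)^o},
    forall u, to_real (f u) = g u.
Proof.
case: s V g => V g; last exact: complexification.
have gl : linear (g : V -> R^o) by move=> a u v; exact: (linearP g).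
pose G := GRing.isLinear.Build R V R^o *:%R (g : V -> R^o) gl.
by exists (HB.pack_for {linear V -> R^o} (g : V -> R^o) G).
Qed.

(** Rotating [u] so that [f u] becomes nonnegative, the bound [Re f <= rnorm]
    given by Hahn-Banach becomes a bound on [`|f u|]. *)
Lemma norming_functional (R : realType) (s : scalar_kind)
    (V : normedModType (scalar_field R s)) (x : V) :
  exists2 f : {linear V -> (scalar_field R s)^o},
    forall u, to_real `|f u| <= rnorm u & to_real (f x) = rnorm x.
Proof.
have [g gle gx] := @hahn_banach_at R (realified V) _ x (sublinear_rnorm V).
have [f fg] := extend_real_functional g.
exists f => [u|]; last by rewrite fg gx.
have [c c1 cf] := phase (f u : scalar_field R s).
have -> : `|f u| = f (c *: u) by rewrite linearZ -cf.
by rewrite fg (le_trans (gle _))// rnormZ c1 to_real1 mul1r.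
Qed.

(** * Norm estimates and rank-one operators *)

Section norm_estimates.
Context {R : realType} {s : scalar_kind} {X : normedModType (scalar_field R s)}.
Implicit Types (x y u v w : X).

Lemma to_real_le_norm (a : scalar_field R s) : to_real a <= to_real `|a|.
Proof.
case: s a => /= [a|[a b]]; first exact: ler_norm.
by rewrite (le_trans (ler_norm a))// -sqrtr_sqr ler_wsqrtr// lerDl sqr_ge0.
Qed.

Lemma of_realB (r1 r2 : R) : of_real s (r1 - r2) = of_real s r1 - of_real s r2.
Proof. by apply: (addIr (of_real s r2)); rewrite -of_realD !subrK. Qed.

Lemma of_real_half : of_real s 2^-1 = 2^-1 :> scalar_field R s.
Proof.
apply: (@mulfI _ 2); first by rewrite pnatr_eq0.
rewrite mulfV ?pnatr_eq0// mulr_natl mulr2n -of_realD.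
by rewrite (_ : 2^-1 + 2^-1 = 1 :> R); [exact: of_real1|field].
Qed.

Lemma to_real_abs_of_real (r : R) : to_real `|of_real s r| = `|r|.
Proof.
have [r0|r0] := leP 0 r; first by rewrite to_real_norm_of_real// ger0_norm.
have N : of_real s r = - of_real s (- r).
  by rewrite -[in LHS](opprK r) -sub0r of_realB of_real0 sub0r.
by rewrite N normrN to_real_norm_of_real ?oppr_ge0 ?ltW// ltr0_norm.
Qed.

Lemma rnormN v : rnorm (- v) = rnorm v.
Proof. by rewrite /rnorm normrN. Qed.

Lemma rnormB v w : rnorm (v - w) = rnorm (w - v).
Proof. by rewrite -rnormN opprB. Qed.

Lemma ler_rnorm_dist v w z : rnorm (v - w) <= rnorm (v - z) + rnorm (z - w).
Proof. by rewrite -[v - w](subrKA z) ler_rnormD. Qed.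

Lemma ler_rnorm_sub v w : rnorm v <= rnorm w + rnorm (v - w).
Proof. by rewrite -{1}[v](subrK w) addrC ler_rnormD. Qed.

Definition normalize v : X := of_real s (rnorm v)^-1 *: v.

Lemma rnorm_normalize v : v != 0 -> rnorm (normalize v) = 1.
Proof.
move=> v0; rewrite /normalize rnormZr ?invr_ge0 ?rnorm_ge0// mulVf//.
by apply: contra v0 => /eqP/rnorm0_eq0 ->.
Qed.

Lemma rnorm_normalizeB v : v != 0 -> rnorm (normalize v - v) = `|1 - rnorm v|.
Proof.
move=> v0; have nv0 : rnorm v != 0.
  by apply: contra v0 => /eqP/rnorm0_eq0 ->.
have -> : normalize v - v = of_real s ((rnorm v)^-1 - 1) *: v.
  by rewrite of_realB of_real1 scalerBl scale1r.
rewrite rnormZ to_real_abs_of_real -{2}(ger0_norm (rnorm_ge0 v)) -normrM.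
by rewrite mulrBl mulVf// mul1r.
Qed.

(** A point of [D] within [e] of [w] has norm within [2 e] of 1, so normalizing
    it moves it by at most another [2 e]. *)
Lemma dense_sphere (D : set X) w (e : R) : dense D -> 0 < e -> e <= 1 / 2 ->
    1 - e < rnorm w -> rnorm w <= 1 ->
  exists d, [/\ D d, d != 0 & rnorm (normalize d - w) < 3 * e].
Proof.
move=> dD e0 e2 w1 w2.
have ep : 0 < of_real s e by rewrite -of_real0 ltr_of_real.
have [d [wd Dd]] : ball w (of_real s e) `&` D !=set0.
  by apply: dD; [exists w; exact: ballxx|exact: ball_open].
have dw : rnorm (d - w) < e.
  rewrite rnormB; move: wd; rewrite -ball_normE /= -of_real_rnorm.
  by rewrite ltr_of_real.
have nd1 := ler_rnorm_sub w d; rewrite rnormB in nd1.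
have nd2 := ler_rnorm_sub d w.
have d0 : d != 0 by apply/eqP => d0; move: nd1; rewrite {1}d0 rnorm0; lra.
exists d; split=> //; have := ler_rnorm_dist (normalize d) w d.
rewrite rnorm_normalizeB//.
have : `|1 - rnorm d| <= 2 * e by rewrite ler_norml; apply/andP; split; lra.
lra.
Qed.

(** The modulus of convexity in terms of midpoints; the cap [d <= 1] also deals
    with an infinite modulus, when no two points of the ball are [e] apart. *)
Lemma uniformly_convex_gap (e : R) : uniformly_convex X -> 0 < e -> e <= 2 ->
  exists d : R, [/\ 0 < d, d <= 1 & forall u v, rnorm u <= 1 -> rnorm v <= 1 ->
    1 - d < rnorm (2^-1 *: (u + v)) -> rnorm (u - v) < e].
Proof.
move=> ucX e0 e2; have m0 := ucX e e0 e2.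
have [d [d0 d1 dm]] : exists d : R,
    [/\ 0 < d, d <= 1 & (d%:E <= modulus_convexity X e)%E].
  case: (modulus_convexity X e) m0 => [m m0|_|//]; last first.
    by exists 1; rewrite ltr01 leey.
  exists (Num.min m 1); rewrite lt_min ltr01 andbT ge_min lexx orbT lee_fin.
  by rewrite ge_min lexx; split=> //; rewrite -lte_fin.
exists d; split=> // u v u1 v1 uv; rewrite ltNge; apply/negP => euv.
have : (modulus_convexity X e <= (1 - rnorm (2^-1 *: (u + v)))%:E)%E.
  by apply: ereal_inf_lbound; exists (u, v).
by move/(le_trans dm); rewrite lee_fin; lra.
Qed.

Lemma rank_one_operator (f : {linear X -> (scalar_field R s)^o}) (y : X) :
  (forall u, to_real `|f u| <= rnorm u) ->
  exists2 S : bop X, finite_rank S & forall u, S u = (f u : scalar_field R s) *: y.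
Proof.
move=> f1; pose S u := (f u : scalar_field R s) *: y.
have bS : S \in @bounded_linear_pred R s X.
  rewrite inE; split=> [a u v|]; first by rewrite /S linearP scalerDl -scalerA.
  by exists (rnorm y) => u; rewrite rnormZ mulrC ler_wpM2l ?rnorm_ge0.
exists (Bop bS) => //; exists 1%N, (fun=> y) => u; exists (fun=> f u).
by rewrite big_ord1.
Qed.

Lemma opnorm_gt (T : bop X) (a : R) : a < rnorm T ->
  exists2 u, rnorm u <= 1 & a < rnorm (T u).
Proof.
rewrite rnorm_bop => aT; have [_ [u /= u1 <-] au] := sup_gt (opnorm_has_sup T).1 aT.
by exists u.
Qed.

(** With [sigma = 2 / d], a drop of [|f u|] by [d] below 1 shortens [S u] by 2,
    more than enough to make room for [T u], of norm at most 1.  When there is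
    no such drop, [u] is close to [x] up to rotation, so [T u] is close to [y]
    and [S u] is a multiple of [y]: the two partly cancel. *)
Lemma rank_one_ball (d : R) (x y : X) : 0 < d -> d <= 1 ->
    (forall u v, rnorm u <= 1 -> rnorm v <= 1 ->
      1 - d < rnorm (2^-1 *: (u + v)) -> rnorm (u - v) < 1 / 4) ->
    rnorm x = 1 -> rnorm y = 1 ->
  exists S : bop X, [/\ finite_rank S, 2 / d <= rnorm S &
    forall T : bop X, rnorm T <= 1 -> rnorm (T x - y) <= 1 / 4 ->
      rnorm (T - S) <= 2 / d - 1 / 2].
Proof.
move=> d0 d1 gap x1 y1; pose sg : R := 2 / d.
have sgd : sg * d = 2 by rewrite /sg divfK// gt_eqF.
have sg2 : 2 <= sg by rewrite /sg ler_pdivlMr//; lra.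
have sg0 : 0 <= sg by lra.
have [f f1 fx] := norming_functional x.
have [S frS SE] := rank_one_operator (of_real s sg *: y) f1.
have {}SE u : S u = (f u * of_real s sg) *: y by rewrite SE scalerA.
have nS u : rnorm (S u) = to_real `|f u : scalar_field R s| * sg.
  by rewrite SE rnormZ y1 mulr1 normrM to_realM// to_real_norm_of_real.
have fx1 : 1 <= to_real `|f x : scalar_field R s|.
  by rewrite -x1 -fx; apply: to_real_le_norm.
exists S; split=> // [|T T1 Txy].
  rewrite rnorm_bop.
  have xle1 : rnorm x <= 1 by rewrite x1.
  have := opnorm_ub S xle1; rewrite nS.
  by move=> /(le_trans _)-> //; rewrite -/sg ler_peMl.
have Tle u : rnorm (T u) <= rnorm u.
  by rewrite (le_trans (opnormP T u))// -rnorm_bop ler_piMl// rnorm_ge0.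
rewrite rnorm_bop; apply: opnorm_lub => u u1.
have [fu|fu] := leP (to_real `|f u : scalar_field R s|) (1 - d).
  have := ler_rnormD (T u) (- S u); rewrite rnormN nS.
  have : to_real `|f u : scalar_field R s| * sg <= (1 - d) * sg by rewrite ler_wpM2r.
  have := Tle u; rewrite -/sg => *; rewrite -[rnorm _]/(rnorm (T u - S u)); lra.
(* From here on, u is replaced by its rotation v, for which f v >= 0. *)
have [c c1 cf] := phase (f u : scalar_field R s).
pose v := c *: u.
have nv w : rnorm (c *: w) = rnorm w.
  by rewrite rnormZ c1 to_real1 mul1r.
have fv : f v = `|f u : scalar_field R s| by rewrite /v linearZ -cf.
have v1 : rnorm v <= 1 by rewrite nv.
have fu1 : to_real `|f u : scalar_field R s| <= 1 by exact: le_trans u1.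
have xv : rnorm (v - x) < 1 / 4.
  apply: gap; rewrite ?x1//.
  rewrite -of_real_half rnormZr ?invr_ge0//.
  have : to_real (f (v + x) : scalar_field R s) <= rnorm (v + x).
    exact: le_trans (to_real_le_norm _) (f1 _).
  rewrite linearD to_realD fx x1 fv; lra.
rewrite -nv -linearZ -/v -[rnorm _]/(rnorm (T v - S v)).
pose a := to_real `|f u : scalar_field R s|.
pose w := of_real s (1 - a * sg) *: y.
have -> : T v - S v = T (v - x) + ((T x - y) + w).
  rewrite linearB SE fv /w of_realB of_realM of_realK// scalerBl.
  rewrite of_real1 scale1r.
  by rewrite !addrA subrK subrK.
have H1 := ler_rnormD (T (v - x)) ((T x - y) + w).
have H2 := ler_rnormD (T x - y) w.
have H3 : rnorm w <= sg - 1.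
  rewrite /w rnormZ y1 mulr1 to_real_abs_of_real ler_norml.
  have : a * sg <= 1 * sg by rewrite ler_wpM2r.
  have : (1 - d) * sg <= a * sg by rewrite ler_wpM2r// ltW.
  by move=> *; apply/andP; split; lra.
have H4 := Tle (v - x); rewrite -/sg; lra.
Qed.

End norm_estimates.

(** * The uniform ball-covering property *)

Theorem corollary3p3 (R : realType) (s : scalar_kind)
    (X : completeNormedModType (scalar_field R s)) (lambda : R) (Z : set (bop X)) :
  separable_space X ->
  uniformly_convex X ->
  pi_property X lambda ->
  1 <= lambda ->
  (lambda%:E < Lambda_const X)%E ->
  is_subspace Z ->
  closed Z ->
  @finite_rank R s X `<=` Z ->
  UBCP Z.
Proof.
move=> [D cD dD] ucX _ _ _ [Z0 _] _ frZ.
have [|nZ] := pselect (Z = [set 0]); [by left|right].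
have [x0 x01] : exists x0 : X, rnorm x0 = 1.
  have [v v0] : exists v : X, v != 0.
    apply: contrapT => noX; apply: nZ; apply/seteqP; split=> [T _|_ ->//].
    apply: bopE => u; apply/eqP/negPn/negP => Tu; apply: noX.
    by exists (T u).
  by exists (normalize v); exact: rnorm_normalize.
have [||d [d0 d1 gap]] := @uniformly_convex_gap _ _ _ (1 / 4) ucX; [lra|lra|].
have d2 : 2 <= 2 / d by rewrite ler_pdivlMr//; lra.
have /pcard_surjP[g gD] := cD.
(* x0 is a unit vector standing in for the zero vector, which cannot be
   normalized. *)
pose e (i : nat) : X := if g i == 0 then x0 else normalize (g i).
have e1 i : rnorm (e i) = 1.
  by rewrite /e; case: ifPn => // gi0; exact: rnorm_normalize.
have e_dense (w : X) (eps : R) : 0 < eps -> eps <= 1 / 2 ->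
    1 - eps < rnorm w -> rnorm w <= 1 -> exists i, rnorm (e i - w) < 3 * eps.
  move=> eps0 eps1 w1 w2.
  have [v [Dv v0 vw]] := dense_sphere dD eps0 eps1 w1 w2.
  by have [i _ giv] := gD _ Dv; exists i; rewrite /e giv (negbTE v0).
have /choice[S SP] (ij : nat * nat) : exists S : bop X,
    [/\ finite_rank S, 2 / d <= rnorm S & forall T : bop X, rnorm T <= 1 ->
      rnorm (T (e ij.1) - e ij.2) <= 1 / 4 -> rnorm (T - S) <= 2 / d - 1 / 2].
  exact: rank_one_ball d0 d1 gap (e1 _) (e1 _).
pose z (k : nat) := S (odflt (0, 0)%N (unpickle k)).
exists (2 / d - 1 / 4), z; split.
- by lra.
- by move=> k; apply: frZ; have [] := SP (odflt (0, 0)%N (unpickle k)).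
- move=> T [_ /= T1].
  have Tle u : rnorm (T u) <= rnorm u.
    by rewrite (le_trans (opnormP T u))// -rnorm_bop T1 mul1r.
  (* A vector of norm above 1 - a is within 3 a of some e i: a defect of 1/48
     at T u becomes 4/48 at T (e i), which e j then approximates within
     12/48 = 1/4, as the balls require. *)
  have [u u1 Tu] : exists2 u, rnorm u <= 1 & 1 - 1 / 48 < rnorm (T u).
    by apply: opnorm_gt; rewrite T1; lra.
  have [||||i iu] := e_dense u (1 / 48); [lra|lra| |by []|].
    by have := Tle u; lra.
  have Ti := ler_rnorm_sub (T u) (T (e i)).
  rewrite rnormB -linearB in Ti; have Tiu := Tle (e i - u).
  have [||||j jT] := e_dense (T (e i)) (4 / 48); [lra|lra|lra| |].
    by rewrite -(e1 i).
  exists (pickle (i, j)) => //=; rewrite /z pickleK /=.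
  have [_ _ /(_ T)] := SP (i, j); rewrite T1 /= rnormB => /(_ (lexx _)) ST.
  by have := ST (ltac:(lra)); lra.
- apply: (@lt_le_trans _ _ (2 / d)); first lra.
  apply: lb_le_inf; first by exists (rnorm (z 0)), 0%N.
  by move=> _ [k _ <-]; have [] := SP (odflt (0, 0)%N (unpickle k)).
Qed.
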